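(* Let $R$ be a commutative ring and let $s\in R$. For every integer $n\geq 2$ there exists a group homomorphism $\mathcal{W}_n\colon G(T_s,n)\to G(T_{s^2},n-1)$ such that $\mathcal{W}_n\circ i=j$ as maps $G(T_s,n-1)\to G(T_{s^2},n-1)$ and $i\circ\mathcal{W}_n=j$ as maps $G(T_s,n)\to G(T_{s^2},n)$.
   Context: All chain complexes vanish in negative degrees. For an integer $n\geq 0$, $\mathcal{P}(R,n)$ is the category of chain complexes $P_\bullet$ of finitely-generated projective $R$-modules with $P_i=0$ for $i\notin[0,n]$. For $s\in R$, $T_s$ is the DGA over $R$ with underlying graded algebra $R[e]$, $\deg e=1$, with differential determined by $de=s$ (so $d(e^m)=0$ for $m$ even and $d(e^m)=se^{m-1}$ for $m$ odd). Giving a left $T_s$-module structure on a chain complex $C$ of $R$-modules (extending the $R$-structure) is the same as giving an $R$-linear null-homotopy $e\colon C_i\to C_{i+1}$ (all $i$) with $d(e.x)+e.(dx)=sx$. $\mathcal{P}(T_s,n)$ is the category of dg-modules over $T_s$ whose underlying chain complex lies in $\mathcal{P}(R,n)$. $G(T_s,n)$ is the quotient of the free abelian group on isomorphism classes of objects of $\mathcal{P}(T_s,n)$ by the relations (1) $[X]=[X']+[X'']$ for every short exact sequence $0\to X'\to X\to X''\to 0$ in $\mathcal{P}(T_s,n)$; (2) $[X]=0$ if $H_*(X)=0$. The maps $i\colon G(T_s,n-1)\to G(T_s,n)$ and $i\colon G(T_{s^2},n-1)\to G(T_{s^2},n)$ are induced by the inclusions $\mathcal{P}(T_s,n-1)\hookrightarrow\mathcal{P}(T_s,n)$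 and $\mathcal{P}(T_{s^2},n-1)\hookrightarrow\mathcal{P}(T_{s^2},n)$. The maps $j\colon G(T_s,m)\to G(T_{s^2},m)$ are induced by restriction of scalars along the DGA map $T_{s^2}\to T_s$ sending $e\mapsto se$. *)

(* Defs.v *)
From HB Require Import structures.
From mathcomp Require Import all_boot all_algebra.
From Stdlib Require Import FunctionalExtensionality PropExtensionality.
From Stdlib Require Import ProofIrrelevance IndefiniteDescription.

Set Implicit Arguments.
Unset Strict Implicit.
Unset Printing Implicit Defensive.

Import GRing.Theory.
Local Open Scope ring_scope.

(* Abelian groups.  The objects of P(T_s, n) carry modules of type lmodType R,
   so the type of these objects lies in a universe strictly above the one in
   which MathComp's eqType, choiceType and zmodType live: a zmodType generated
   by such objects is a universe inconsistency.  Hence this plain record. *)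

Record abGroup := AbGroup {
  ab_sort :> Type;
  ab_zero : ab_sort;
  ab_opp : ab_sort -> ab_sort;
  ab_add : ab_sort -> ab_sort -> ab_sort;
  ab_addA : associative ab_add;
  ab_addC : commutative ab_add;
  ab_add0 : left_id ab_zero ab_add;
  ab_addN : left_inverse ab_zero ab_opp ab_add
}.

Record abHom (A B : abGroup) := AbHom {
  ab_fun :> A -> B;
  ab_funD : forall x y : A, ab_fun (ab_add x y) = ab_add (ab_fun x) (ab_fun y)
}.

(* Abelian group presented by a type T of generators and a set rel of relations
   between words, i.e. the quotient of the free abelian group on T by the
   subgroup generated by the differences u - v with rel u v.  It is realised as
   the set of classes of formal words modulo the congruence generated by the
   axioms of abelian groups and by rel. *)

Inductive word (T : Type) :=
  | Gen of T
  | Zero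
  | Opp of word T
  | Add of word T & word T.
Arguments Zero {T}.

Section Presentation.
Variables (T : Type) (rel : word T -> word T -> Prop).

Inductive weq : word T -> word T -> Prop :=
  | weq_rel u v : rel u v -> weq u v
  | weq_refl u : weq u u
  | weq_sym u v : weq u v -> weq v u
  | weq_trans v u w : weq u v -> weq v w -> weq u w
  | weq_opp u v : weq u v -> weq (Opp u) (Opp v)
  | weq_add u u' v v' : weq u u' -> weq v v' -> weq (Add u v) (Add u' v')
  | weq_addA u v w : weq (Add u (Add v w)) (Add (Add u v) w)
  | weq_addC u v : weq (Add u v) (Add v u)
  | weq_add0 u : weq (Add Zero u) u
  | weq_addN u : weq (Add (Opp u) u) Zero.

Record pres_sort := PresSort {
  pres_class : word T -> Prop;
  pres_classP : exists w, pres_class = weq w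
}.

Definition pi (w : word T) : pres_sort :=
  PresSort (ex_intro (fun v => weq w = weq v) w erefl).

Definition rep (x : pres_sort) : word T :=
  sval (constructive_indefinite_description _ (pres_classP x)).

Lemma pres_sort_inj x y : pres_class x = pres_class y -> x = y.
Proof.
case: x y => [c p] [d q] /= cd; rewrite -cd in q *.
by congr PresSort; apply: proof_irrelevance.
Qed.

Lemma piK : cancel rep pi.
Proof.
move=> x; apply: pres_sort_inj; rewrite /rep /=.
by case: constructive_indefinite_description.
Qed.

Lemma pi_eqP u v : pi u = pi v <-> weq u v.
Proof.
split=> [[->]|uv]; first exact: weq_refl.
apply: pres_sort_inj; apply: functional_extensionality => w.
apply: propositional_extensionality.
by split; apply: weq_trans => //; apply: weq_sym.
Qed.

Lemma rep_pi w : weq (rep (pi w)) w.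
Proof. by apply/pi_eqP; rewrite piK. Qed.

Definition pres_add x y := pi (Add (rep x) (rep y)).
Definition pres_opp x := pi (Opp (rep x)).

Lemma pi_add u v : pi (Add u v) = pres_add (pi u) (pi v).
Proof. by apply/pi_eqP; apply: weq_add; apply: weq_sym; apply: rep_pi. Qed.

Lemma pi_opp u : pi (Opp u) = pres_opp (pi u).
Proof. by apply/pi_eqP; apply: weq_opp; apply: weq_sym; apply: rep_pi. Qed.

Lemma pres_addA : associative pres_add.
Proof.
move=> x y z; rewrite -[x]piK -[y]piK -[z]piK -!pi_add.
by apply/pi_eqP; apply: weq_addA.
Qed.

Lemma pres_addC : commutative pres_add.
Proof. by move=> x y; apply/pi_eqP; apply: weq_addC. Qed.

Lemma pres_add0 : left_id (pi Zero) pres_add.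
Proof. by move=> x; rewrite -[x]piK -pi_add; apply/pi_eqP; apply: weq_add0. Qed.

Lemma pres_addN : left_inverse (pi Zero) pres_opp pres_add.
Proof.
by move=> x; rewrite -[x]piK -pi_opp -pi_add; apply/pi_eqP; apply: weq_addN.
Qed.

Definition pres : abGroup :=
  AbGroup pres_addA pres_addC pres_add0 pres_addN.

Definition cls (t : T) : pres := pi (Gen t).

Fixpoint weval (A : abGroup) (f : T -> A) (w : word T) : A :=
  match w with
  | Gen t => f t
  | Zero => ab_zero A
  | Opp u => ab_opp (weval f u)
  | Add u v => ab_add (weval f u) (weval f v)
  end.

Section Lift.
Variables (A : abGroup) (f : T -> A).
Hypothesis fP : forall u v, rel u v -> weval f u = weval f v.

Lemma weval_weq u v : weq u v -> weval f u = weval f v.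
Proof.
elim=> {u v} //=.
- by move=> v u w _ -> _ ->.
- by move=> u v _ ->.
- by move=> u u' v v' _ -> _ ->.
- by move=> u v w; apply: ab_addA.
- by move=> u v; apply: ab_addC.
- by move=> u; apply: ab_add0.
- by move=> u; apply: ab_addN.
Qed.

Lemma pres_liftD (x y : pres) :
  weval f (rep (ab_add x y)) = ab_add (weval f (rep x)) (weval f (rep y)).
Proof. by rewrite (weval_weq (rep_pi _)). Qed.

Definition pres_lift : abHom pres A := AbHom pres_liftD.

Lemma pres_lift_cls t : pres_lift (cls t) = f t.
Proof. exact: (weval_weq (rep_pi _)). Qed.

End Lift.

Lemma abHom0 (A B : abGroup) (f : abHom A B) : f (ab_zero A) = ab_zero B.
Proof.
set z := f _; have zz : ab_add z z = z by rewrite -ab_funD ab_add0.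
by rewrite -[LHS](ab_add0) -(ab_addN z) -ab_addA zz.
Qed.

Lemma abHomN (A B : abGroup) (f : abHom A B) x : f (ab_opp x) = ab_opp (f x).
Proof.
rewrite -[LHS]ab_add0 ab_addC -(ab_addN (f x)) [ab_add _ (f x)]ab_addC.
by rewrite ab_addA -ab_funD ab_addN abHom0 ab_add0.
Qed.

Lemma pres_hom_ext (A : abGroup) (g h : abHom pres A) :
  (forall t, g (cls t) = h (cls t)) -> forall x, g x = h x.
Proof.
move=> gh x; rewrite -[x]piK; elim: (rep x) => {x} //= [|u IH|u IHu v IHv].
- by rewrite -[pi Zero]/(ab_zero pres) !abHom0.
- by rewrite pi_opp -[pres_opp _]/(@ab_opp pres _) !abHomN IH.
- by rewrite pi_add -[pres_add _ _]/(@ab_add pres _ _) !ab_funD IHu IHv.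
Qed.

End Presentation.

Section Modules.
Variables (R : comPzRingType) (M : lmodType R).

Definition fin_gen : Prop :=
  exists (k : nat) (v : 'I_k -> M),
    forall x : M, exists a : 'I_k -> R, x = \sum_i a i *: v i.

Definition projective : Prop :=
  forall (A B : lmodType R) (g : {linear A -> B}) (f : {linear M -> B}),
    (forall b, exists a, g a = b) ->
    exists h : {linear M -> A}, forall x, g (h x) = f x.

End Modules.

Record complex (R : comPzRingType) := Complex {
  cpx_mod :> nat -> lmodType R;
  cpx_d : forall i, {linear cpx_mod i.+1 -> cpx_mod i};
  cpx_dd : forall i (x : cpx_mod i.+2), cpx_d i (cpx_d i.+1 x) = 0
}.

Definition in_P (R : comPzRingType) (n : nat) (C : complex R) : Prop :=
  (forall i, fin_gen (C i) /\ projective (C i)) /\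
  (forall i, (n < i)%N -> forall x : C i, x = 0).

Definition acyclic (R : comPzRingType) (C : complex R) : Prop :=
  (forall x : C 0%N, exists y, cpx_d C 0 y = x) /\
  (forall i (x : C i.+1), cpx_d C i x = 0 -> exists y, cpx_d C i.+1 y = x).

(* dg-modules over T_s = R[e], de = s.  As the algebra R[e] is free on e, the
   T_s-action amounts to the action of e; e^2 need not act by 0.  The condition
   d(e x) + e(d x) = s x is split according to whether x has degree 0, where
   d x = 0, or positive degree. *)
Record dgmod (R : comPzRingType) (s : R) := DgMod {
  dg_cpx :> complex R;
  dg_e : forall i, {linear dg_cpx i -> dg_cpx i.+1};
  dg_e0 : forall x : dg_cpx 0%N, cpx_d dg_cpx 0 (dg_e 0 x) = s *: x;
  dg_eS : forall i (x : dg_cpx i.+1),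
    cpx_d dg_cpx i.+1 (dg_e i.+1 x) + dg_e i (cpx_d dg_cpx i x) = s *: x
}.

Record dgHom (R : comPzRingType) (s : R) (X Y : dgmod s) := DgHom {
  dgh_fun : forall i, {linear X i -> Y i};
  dgh_d : forall i (x : X i.+1),
    dgh_fun i (cpx_d X i x) = cpx_d Y i (dgh_fun i.+1 x);
  dgh_e : forall i (x : X i), dgh_fun i.+1 (dg_e X i x) = dg_e Y i (dgh_fun i x)
}.

Definition dg_iso (R : comPzRingType) (s : R) (X Y : dgmod s) : Prop :=
  exists (f : dgHom X Y) (g : dgHom Y X),
    (forall i x, dgh_fun g i (dgh_fun f i x) = x) /\
    (forall i y, dgh_fun f i (dgh_fun g i y) = y).

Definition short_exact (R : comPzRingType) (s : R) (X' X X'' : dgmod s)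
    (f : dgHom X' X) (g : dgHom X X'') : Prop :=
  forall i,
    [/\ injective (dgh_fun f i),
        (forall z, exists x, dgh_fun g i x = z)
      & forall x, dgh_fun g i x = 0 <-> exists y, dgh_fun f i y = x].

Record PT (R : comPzRingType) (s : R) (n : nat) := PTObj {
  pt_dg :> dgmod s;
  pt_in_P : in_P n pt_dg
}.

(* G_iso identifies isomorphic objects, i.e. passes from the free abelian group
   on objects to the free abelian group on isomorphism classes. *)
Inductive G_rel (R : comPzRingType) (s : R) (n : nat) :
    word (PT s n) -> word (PT s n) -> Prop :=
  | G_iso (X Y : PT s n) : dg_iso X Y -> G_rel (Gen X) (Gen Y)
  | G_ses (X' X X'' : PT s n) (f : dgHom X' X) (g : dgHom X X'') :
      short_exact f g -> G_rel (Gen X) (Add (Gen X') (Gen X''))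
  | G_acyclic (X : PT s n) : acyclic X -> G_rel (Gen X) Zero.

Definition G (R : comPzRingType) (s : R) (n : nat) : abGroup :=
  pres (@G_rel R s n).

Section Inclusion.
Variables (R : comPzRingType) (s : R) (m n : nat) (le_mn : (m <= n)%N).

Lemma incl_in_P (X : PT s m) : in_P n X.
Proof.
by split=> [|i ni]; [case: (pt_in_P X) | apply: (pt_in_P X).2 (leq_ltn_trans le_mn ni)].
Qed.

Definition incl (X : PT s m) : PT s n := PTObj (incl_in_P X).

Lemma incl_rel u v : G_rel u v ->
  weval (fun X => cls (@G_rel R s n) (incl X)) u
  = weval (fun X => cls (@G_rel R s n) (incl X)) v.
Proof.
case=> [X Y XY|X' X X'' f g fg|X X0] /=; rewrite -?pi_add; apply/pi_eqP;
  apply: weq_rel.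
- exact: G_iso.
- exact: (@G_ses _ _ _ (incl X') (incl X) (incl X'') f g).
- exact: G_acyclic.
Qed.

Definition G_incl : abHom (G s m) (G s n) := pres_lift incl_rel.

Lemma G_inclE X : G_incl (cls _ X) = cls _ (incl X).
Proof. exact: pres_lift_cls. Qed.

End Inclusion.

(* Restriction of scalars along T_{s^2} -> T_s, e |-> s e. *)
Section Restriction.
Variables (R : comPzRingType) (s : R).

Section Object.
Variable X : dgmod s.

Definition restr_e i : {linear X i -> X i.+1} := s \*: dg_e X i.

Lemma restr_e0 (x : X 0%N) : cpx_d X 0 (restr_e 0 x) = s ^+ 2 *: x.
Proof. by rewrite linearZ /= dg_e0 scalerA -expr2. Qed.

Lemma restr_eS i (x : X i.+1) :
  cpx_d X i.+1 (restr_e i.+1 x) + restr_e i (cpx_d X i x) = s ^+ 2 *: x.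
Proof. by rewrite linearZ /= -scalerDr dg_eS scalerA -expr2. Qed.

Definition restr_dg : dgmod (s ^+ 2) := DgMod restr_e0 restr_eS.

End Object.

Lemma restr_homP (X Y : dgmod s) (f : dgHom X Y) i (x : X i) :
  dgh_fun f i.+1 (restr_e X i x) = restr_e Y i (dgh_fun f i x).
Proof. by rewrite linearZ /= dgh_e. Qed.

Definition restr_hom (X Y : dgmod s) (f : dgHom X Y) :
    dgHom (restr_dg X) (restr_dg Y) :=
  @DgHom R (s ^+ 2) (restr_dg X) (restr_dg Y)
    (dgh_fun f) (dgh_d f) (restr_homP f).

Variable n : nat.

Definition restr (X : PT s n) : PT (s ^+ 2) n :=
  @PTObj R (s ^+ 2) n (restr_dg X) (pt_in_P X).

Lemma restr_rel u v : G_rel u v ->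
  weval (fun X => cls (@G_rel R (s ^+ 2) n) (restr X)) u
  = weval (fun X => cls (@G_rel R (s ^+ 2) n) (restr X)) v.
Proof.
case=> [X Y [f [g [fg gf]]]|X' X X'' f g fg|X X0] /=; rewrite -?pi_add;
  apply/pi_eqP; apply: weq_rel.
- by apply: G_iso; exists (restr_hom f), (restr_hom g).
- exact: (@G_ses _ _ _ (restr X') (restr X) (restr X'')
            (restr_hom f) (restr_hom g)).
- exact: G_acyclic.
Qed.

Definition G_restr : abHom (G s n) (G (s ^+ 2) n) := pres_lift restr_rel.

Lemma G_restrE X : G_restr (cls _ X) = cls _ (restr X).
Proof. exact: pres_lift_cls. Qed.

End Restriction.

(* Main.v *)
Require Import Defs.
From HB Require Import structures.
From mathcomp Require Import all_boot all_algebra.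
From Stdlib Require Import IndefiniteDescription.

(* Write n = m + 2 and let d, e be the operators of X.  Moving X_n down to degree
   m keeps a differential (d, e) : X_(m+1) -> X_m + X_n and a homotopy, except
   that the homotopy is one for s only up to the nilpotent map e^2 : X_m -> X_n.
   Over T_(s^2) the correction term e^3 : X_(m-1) -> X_n repairs this, and yields
   a T_(s^2)-module fold X in degrees [0, n-1].  With kos X the complex
   s : X_n -> X_n in degrees m+1 and m, put W [X] = [fold X] - [kos X].

   - i W = j: the T_(s^2)-module stab X is an extension of X by kos X, and fold X
     is its quotient by the acyclic submodule spanned by X_n and d X_n.
   - If h : X_(m+1) -> X_n satisfies h d = 1 on X_n, there is a short exact
     sequence kos X -> fold X -> X' where X' is the quotient of X by the acyclic
     submodule X_n -> d X_n, so W [X] = [X'].  For X acyclic a contracting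
     homotopy provides h, and X' is acyclic: W [X] = 0.  For X_n = 0 the choice
     h = 0 gives X' = X, that is W i = j. *)

Set Implicit Arguments.
Unset Strict Implicit.
Unset Printing Implicit Defensive.

Import GRing.Theory.
Local Open Scope ring_scope.

(** * Linear algebra *)

Section Kernel.
Variables (R : comPzRingType) (M N : lmodType R) (f : {linear M -> N}).

Definition ker_pred : {pred M} := [pred x | f x == 0].

Fact ker_pred_submod : submod_closed ker_pred.
Proof.
split=> [|a x y]; rewrite !inE ?linear0 // => /eqP fx /eqP fy.
by rewrite linearP fx fy scaler0 addr0.
Qed.
HB.instance Definition _ := GRing.isSubmodClosed.Build R M ker_pred ker_pred_submod.

Record ker := Ker { ker_val :> M; _ : ker_val \in ker_pred }.
HB.instance Definition _ := [isSub for ker_val].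
HB.instance Definition _ := [Choice of ker by <:].
HB.instance Definition _ := [SubChoice_isSubLmodule of ker by <:].

Lemma kerP (x : ker) : f (val x) = 0.
Proof. by case: x => x /= /eqP. Qed.

End Kernel.

Section LinearMaps.
Variable R : comPzRingType.
Implicit Types (A B L M N : lmodType R) (b : bool).

Definition mklin M N (f : M -> N) (lf : linear f) : {linear M -> N} :=
  HB.pack f (GRing.isLinear.Build R M N _ f lf).

Section KernelLift.
Variables (L M N : lmodType R) (f : {linear M -> N}) (g : {linear L -> M}).
Hypothesis fg0 : forall x, f (g x) = 0.

Fact ker_lift_subproof x : g x \in ker_pred f.
Proof. by rewrite inE fg0. Qed.

Fact ker_lift_linear : linear (fun x => Ker (ker_lift_subproof x)).
Proof. by move=> a x y; apply: val_inj; rewrite /= linearP. Qed.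

Definition ker_lift : {linear L -> ker f} := mklin ker_lift_linear.

End KernelLift.

Section Pairing.
Variables (L M N : lmodType R) (f : {linear L -> M}) (g : {linear L -> N}).

Fact lin_pair_linear : linear (fun x => (f x, g x)).
Proof. by move=> a x y; rewrite !linearP. Qed.

Definition lin_pair : {linear L -> (M * N)%type} := mklin lin_pair_linear.

End Pairing.

(* Since [i.+1 == m.+1] computes to [i == m], [cond (i.+1 == m.+1) M] and
   [cond (i == m) M] are convertible; the maps of [kos] below rely on this. *)
Definition cond (b : bool) M : lmodType R := if b then M else 'rV[R]_0.

Definition cin b M : {linear cond b M -> M} :=
  if b return {linear cond b M -> M}
  then idfun : {linear M -> M} else \0 : {linear 'rV[R]_0 -> M}.

Definition cproj b M : {linear M -> cond b M} :=
  if b return {linear M -> cond b M}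
  then idfun : {linear M -> M} else \0 : {linear M -> 'rV[R]_0}.

Definition cmap b M N (f : {linear M -> N}) : {linear cond b M -> cond b N} :=
  if b return {linear cond b M -> cond b N}
  then f else \0 : {linear 'rV[R]_0 -> 'rV[R]_0}.

Lemma cond_false M (x y : cond false M) : x = y.
Proof. by rewrite [x](@thinmx0 R 1) [y](@thinmx0 R 1). Qed.

Lemma cond_eq0 b M (x : cond b M) : ~~ b -> x = 0.
Proof. by case: b x => // x _; apply: cond_false. Qed.

Lemma cinK b M : cancel (cin b M) (cproj b M).
Proof. by case: b => //= x; apply: cond_false. Qed.

Lemma cprojK b M x : cin b M (cproj b M x) = if b then x else 0.
Proof. by case: b. Qed.

Lemma cin_cmap b M N (f : {linear M -> N}) x : cin b N (cmap b f x) = f (cin b M x).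
Proof. by case: b x => //= x; rewrite linear0. Qed.

Lemma cproj_nat b M N (f : {linear M -> N}) x : cproj b N (f x) = cmap b f (cproj b M x).
Proof. by case: b. Qed.

Lemma cproj_eq0 b M (x : M) : (b -> x = 0) -> cproj b M x = 0.
Proof. by case: b => [/(_ isT) -> | _]; rewrite ?linear0. Qed.

Lemma cproj_add_eq0 b M (x y : M) :
  (b -> x + y = 0) -> cproj b M x + cproj b M y = 0.
Proof. by rewrite -linearD; apply: cproj_eq0. Qed.

Lemma cproj_addZ_eq0 b M (a : R) (x y : M) :
  (b -> x + a *: y = 0) -> cproj b M x + a *: cproj b M y = 0.
Proof. by rewrite -linearZ; apply: cproj_add_eq0. Qed.

Lemma cin_eq0 b M (x : cond b M) : ~~ b -> cin b M x = 0.
Proof. by move=> /(cond_eq0 x) ->; apply: linear0. Qed.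

Definition cut b M : {linear M -> M} := cin b M \o cproj b M.

(** One degree of [short_exact], for bare linear maps, so that exactness can be checked factor by
    factor. *)
Definition exact3 L M N (f : {linear L -> M}) (g : {linear M -> N}) : Prop :=
  [/\ injective f,
      (forall z, exists x, g x = z)
    & forall x, g x = 0 <-> exists y, f y = x].

Lemma exact3_cmap b L M N (f : {linear L -> M}) (g : {linear M -> N}) :
  exact3 f g -> exact3 (cmap b f) (cmap b g).
Proof.
case: b => //= _; split=> [x y _|z|x]; first exact: cond_false.
  by exists 0; apply: cond_false.
by split=> // _; exists 0; apply: cond_false.
Qed.

Definition prod_map M (M' : lmodType R) N (N' : lmodType R)
    (f : {linear M -> N}) (g : {linear M' -> N'}) :
    {linear (M * M')%type -> (N * N')%type} :=
  lin_pair (f \o fst) (g \o snd).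

Lemma exact3_prod L M N (L' M' N' : lmodType R) (f : {linear L -> M}) (g : {linear M -> N})
    (f' : {linear L' -> M'}) (g' : {linear M' -> N'}) :
  exact3 f g -> exact3 f' g' -> exact3 (prod_map f f') (prod_map g g').
Proof.
move=> [fI gS ex] [fI' gS' ex']; split.
- by move=> [x x'] [y y'] /= [/fI -> /fI' ->].
- by move=> [z z']; have [[x <-] [x' <-]] := (gS z, gS' z'); exists (x, x').
move=> [x x']; split=> [/= [/ex [y <-] /ex' [y' <-]]|[[y y'] [<- <-]] /=].
  by exists (y, y').
by congr (_, _); [apply/ex; exists y | apply/ex'; exists y'].
Qed.

(** * Finitely generated projective modules *)

Definition fgp M := fin_gen M /\ projective M.

(** Generators are pushed along [p], and lifts of [f \o p] are restricted along [i]. *)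
Lemma fgp_retract M N (i : {linear N -> M}) (p : {linear M -> N}) :
  cancel i p -> fgp M -> fgp N.
Proof.
move=> ip [[k [v vP]] projM]; split.
  exists k, (p \o v) => x; have [a ix] := vP (i x); exists a.
  by rewrite -[LHS]ip ix linear_sum; apply: eq_bigr => j _; rewrite linearZ.
move=> A B g f gS; have [h hP] := projM A B g (f \o p) gS.
by exists (h \o i) => x; rewrite /= hP /= ip.
Qed.

Lemma fgp_cond b M : fgp M -> fgp (cond b M).
Proof. exact: (fgp_retract (@cinK b M)). Qed.

Lemma fgp_prod M N : fgp M -> fgp N -> fgp (M * N)%type.
Proof.
move=> [[k [v vP]] pM] [[l [w wP]] pN]; split.
  exists (k + l)%N, (fun i =>
    match split i with inl j => (v j, 0) | inr j => (0, w j) end).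
  move=> [x y]; have [[a ->] [b ->]] := (vP x, wP y).
  exists (fun i => match split i with inl j => a j | inr j => b j end).
  rewrite big_split_ord /=.
  have splitl i : split (lshift l i) = inl i := unsplitK (inl i).
  have splitr i : split (rshift k i) = inr i := unsplitK (inr i).
  under [X in _ = X + _]eq_bigr => i _ do rewrite splitl.
  under [X in _ = _ + X]eq_bigr => i _ do rewrite splitr.
  rewrite [RHS]surjective_pairing !raddfD !raddf_sum /=.
  rewrite [X in (_ + X, _)]big1 ?[X in (_, X + _)]big1 ?addr0 ?add0r //.
  - by move=> i _; rewrite scaler0.
  - by move=> i _; rewrite scaler0.
move=> A B g f gS.
(* A map out of the product is lifted on each factor, and the two lifts are added. *)
have [h hP] := pM A B g (f \o lin_pair (idfun : {linear M -> M}) \0) gS.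
have [h' hP'] := pN A B g (f \o lin_pair \0 (idfun : {linear N -> N})) gS.
exists ((h \o fst) \+ (h' \o snd)) => -[x y] /=.
rewrite linearD hP hP' /= -linearD; congr (f (_, _)); rewrite /= ?addr0 ?add0r //.
Qed.

End LinearMaps.

(** * Quotients and extensions of dg-modules *)

Section Composition.
Variables (R : comPzRingType) (t : R) (X Y Z : dgmod t).
Variables (g : dgHom Y Z) (f : dgHom X Y).

Fact dg_comp_d i (x : X i.+1) :
  (dgh_fun g i \o dgh_fun f i) (cpx_d X i x)
  = cpx_d Z i ((dgh_fun g i.+1 \o dgh_fun f i.+1) x).
Proof. by rewrite /= !dgh_d. Qed.

Fact dg_comp_e i (x : X i) :
  (dgh_fun g i.+1 \o dgh_fun f i.+1) (dg_e X i x)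
  = dg_e Z i ((dgh_fun g i \o dgh_fun f i) x).
Proof. by rewrite /= !dgh_e. Qed.

Definition dg_comp : dgHom X Z :=
  @DgHom _ _ X Z (fun i => dgh_fun g i \o dgh_fun f i) dg_comp_d dg_comp_e.

End Composition.

(** * Submodule and quotient cut out by an idempotent *)

Section Split.
Variables (R : comPzRingType) (t : R).

(* The idempotents need not commute with d and e: only their kernels are stable.
   The kernel is then a submodule, and the image, with operators p d and p e,
   represents the quotient; in this way no quotient modules are needed and both
   are degreewise direct summands of X. *)
Record dg_idem (X : dgmod t) := DgIdem {
  idem_fun :> forall i, {linear X i -> X i};
  idemK : forall i x, idem_fun i (idem_fun i x) = idem_fun i x;
  idem_d : forall i x, idem_fun i.+1 x = 0 -> idem_fun i (cpx_d X i x) = 0;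
  idem_e : forall i x, idem_fun i x = 0 -> idem_fun i.+1 (dg_e X i x) = 0
}.

Section Object.
Variables (X : dgmod t) (p : dg_idem X).
Implicit Types i : nat.

Definition sub_mod i : lmodType R := ker (p i).

Lemma sub_modP i (x : sub_mod i) : p i (val x) = 0.
Proof. exact: kerP. Qed.

Definition sub_d i : {linear sub_mod i.+1 -> sub_mod i} :=
  @ker_lift _ _ _ _ (p i) (cpx_d X i \o val) (fun x => idem_d (sub_modP x)).

Definition sub_e i : {linear sub_mod i -> sub_mod i.+1} :=
  @ker_lift _ _ _ _ (p i.+1) (dg_e X i \o val) (fun x => idem_e (sub_modP x)).

Fact sub_dd i (x : sub_mod i.+2) : sub_d i (sub_d i.+1 x) = 0.
Proof. by apply: val_inj; rewrite /= cpx_dd. Qed.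

Definition sub_cpx := Complex sub_dd.

Fact sub_e0 (x : sub_mod 0%N) : sub_d 0 (sub_e 0 x) = t *: x.
Proof. by apply: val_inj; rewrite /= dg_e0. Qed.

Fact sub_eS i (x : sub_mod i.+1) :
  sub_d i.+1 (sub_e i.+1 x) + sub_e i (sub_d i x) = t *: x.
Proof. by apply: val_inj; rewrite /= dg_eS. Qed.

Definition sub_dg : dgmod t := @DgMod _ _ sub_cpx sub_e sub_e0 sub_eS.

Definition sub_hom : dgHom sub_dg X :=
  @DgHom _ _ sub_dg X (fun i => val : {linear sub_mod i -> X i})
    (fun i x => erefl) (fun i x => erefl).

Definition quo_mod i : lmodType R := ker (p i \- idfun).

Lemma quo_modP i (x : quo_mod i) : p i (val x) = val x.
Proof. by apply/eqP; rewrite -subr_eq0; apply/eqP/(kerP x). Qed.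

Fact quo_proj_subproof i x : (p i \- idfun) (p i x) = 0.
Proof. by rewrite /= idemK subrr. Qed.

Definition quo_proj i : {linear X i -> quo_mod i} := ker_lift (@quo_proj_subproof i).

Lemma quo_projK i : cancel (val : quo_mod i -> X i) (quo_proj i).
Proof. by move=> x; apply: val_inj; apply: quo_modP. Qed.

(** The elements [x] and [p x] differ by an element of the kernel of [p], which d preserves. The
    resulting identity p d p = p d lets [quo_d] inherit d d = 0 although [p] need not commute with
    d. *)
Lemma idem_dp i x : p i (cpx_d X i (p i.+1 x)) = p i (cpx_d X i x).
Proof.
apply/eqP; rewrite -subr_eq0 -!linearB /=; apply/eqP; apply: idem_d.
by rewrite linearB /= idemK subrr.
Qed.

Lemma idem_ep i x : p i.+1 (dg_e X i (p i x)) = p i.+1 (dg_e X i x).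
Proof.
apply/eqP; rewrite -subr_eq0 -!linearB /=; apply/eqP; apply: idem_e.
by rewrite linearB /= idemK subrr.
Qed.

Definition quo_d i : {linear quo_mod i.+1 -> quo_mod i} :=
  quo_proj i \o (cpx_d X i \o val).
Definition quo_e i : {linear quo_mod i -> quo_mod i.+1} :=
  quo_proj i.+1 \o (dg_e X i \o val).

Fact quo_dd i (x : quo_mod i.+2) : quo_d i (quo_d i.+1 x) = 0.
Proof. by apply: val_inj; rewrite /= idem_dp cpx_dd linear0. Qed.

Definition quo_cpx := Complex quo_dd.

Fact quo_e0 (x : quo_mod 0%N) : quo_d 0 (quo_e 0 x) = t *: x.
Proof. by apply: val_inj; rewrite /= idem_dp dg_e0 linearZ /= quo_modP. Qed.

Fact quo_eS i (x : quo_mod i.+1) :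
  quo_d i.+1 (quo_e i.+1 x) + quo_e i (quo_d i x) = t *: x.
Proof.
by apply: val_inj; rewrite /= idem_dp idem_ep -linearD /= dg_eS linearZ /= quo_modP.
Qed.

Definition quo_dg : dgmod t := @DgMod _ _ quo_cpx quo_e quo_e0 quo_eS.

Fact quo_hom_d i (x : X i.+1) : quo_proj i (cpx_d X i x) = quo_d i (quo_proj i.+1 x).
Proof. by apply: val_inj; rewrite /= idem_dp. Qed.

Fact quo_hom_e i (x : X i) : quo_proj i.+1 (dg_e X i x) = quo_e i (quo_proj i x).
Proof. by apply: val_inj; rewrite /= idem_ep. Qed.

Definition quo_hom : dgHom X quo_dg := @DgHom _ _ X quo_dg quo_proj quo_hom_d quo_hom_e.

Lemma sub_quo_exact : short_exact sub_hom quo_hom.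
Proof.
move=> i; split=> [x y|z|x] /=; first exact: val_inj.
  by exists (val z); apply: quo_projK.
split=> [/(congr1 val)/= px|[y <-]]; last by apply: val_inj; apply: sub_modP.
have kx : x \in ker_pred (p i) by rewrite inE px.
by exists (Ker kx).
Qed.

(** The bound [m] may lie below [n]: this is how passing to the image of an idempotent lowers the
    top degree. *)
Lemma quo_in_P n m :
  in_P n X -> (forall i, (m < i)%N -> forall x, p i x = 0) -> in_P m quo_dg.
Proof.
move=> [fgX _] p0; split=> [i|i mi x]; first exact: (fgp_retract (@quo_projK i)) (fgX i).
by apply: val_inj; rewrite /= -quo_modP p0.
Qed.

Fact sub_proj_subproof i x : p i ((idfun \- p i) x) = 0.
Proof. by rewrite linearB /= idemK subrr. Qed.

Lemma sub_in_P n : in_P n X -> in_P n sub_dg.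
Proof.
move=> [fgX X0]; split=> [i|i ni x]; last by apply: val_inj; rewrite /= (X0 i ni (val x)).
apply: (@fgp_retract _ _ _ (val : {linear sub_mod i -> X i})
  (ker_lift (@sub_proj_subproof i))) (fgX i).
by move=> x; apply: val_inj; rewrite /= sub_modP subr0.
Qed.

(** If y is a cycle of the quotient, then d y lies in the submodule and is a cycle there, so d y = d
    k with k in the submodule. Now y - k is a cycle of [X], hence a boundary, and it projects to
    y. *)
Lemma quo_acyclic : acyclic X -> acyclic sub_dg -> acyclic quo_dg.
Proof.
move=> [X0 XS] [s0 sS].
have lift i (y : quo_dg i.+1) : cpx_d quo_dg i y = 0 ->
    exists k : sub_dg i.+1, cpx_d X i (val k) = cpx_d X i (val y).
  move=> /(congr1 val)/= py.
  have ky : cpx_d X i (val y) \in ker_pred (p i) by rewrite inE py.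
  suff [k /(congr1 val) /= kE] : exists k, cpx_d sub_dg i k = Ker ky by exists k.
  case: i y {py} ky => [|i] y ky; first exact: s0.
  by apply: sS; apply: val_inj; rewrite /= cpx_dd.
split=> [x|i x dx].
  by have [y yx] := X0 (val x); exists (quo_proj 1 y);
    apply: val_inj; rewrite /= idem_dp yx quo_modP.
have [k kx] := lift _ _ dx.
have [|z zE] := XS i (val x - val k); first by rewrite linearB /= kx subrr.
exists (quo_proj _ z).
by apply: val_inj; rewrite /= idem_dp zE linearB /= sub_modP subr0 quo_modP.
Qed.

End Object.

Section Functor.
Variables (X Y : dgmod t) (p : dg_idem X) (q : dg_idem Y) (f : dgHom X Y).
Hypothesis pq : forall i x, p i x = 0 -> q i (dgh_fun f i x) = 0.

Definition quo_map_fun i : {linear quo_mod p i -> quo_mod q i} :=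
  quo_proj q i \o (dgh_fun f i \o val).

Lemma quo_map_proj i x : quo_map_fun i (quo_proj p i x) = quo_proj q i (dgh_fun f i x).
Proof.
apply: val_inj; apply/eqP; rewrite /= -subr_eq0 -!linearB /=; apply/eqP/pq.
by rewrite linearB /= idemK subrr.
Qed.

Lemma quo_projE i (x : quo_mod p i) : x = quo_proj p i (val x).
Proof. by rewrite quo_projK. Qed.

Fact quo_map_d i (x : quo_dg p i.+1) :
  quo_map_fun i (cpx_d (quo_dg p) i x) = cpx_d (quo_dg q) i (quo_map_fun i.+1 x).
Proof.
by rewrite (quo_projE x) quo_map_proj -!(dgh_d (quo_hom _)) quo_map_proj /= dgh_d.
Qed.

Fact quo_map_e i (x : quo_dg p i) :
  quo_map_fun i.+1 (dg_e (quo_dg p) i x) = dg_e (quo_dg q) i (quo_map_fun i x).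
Proof.
by rewrite (quo_projE x) quo_map_proj -!(dgh_e (quo_hom _)) quo_map_proj /= dgh_e.
Qed.

Definition quo_map : dgHom (quo_dg p) (quo_dg q) :=
  @DgHom _ _ (quo_dg p) (quo_dg q) quo_map_fun quo_map_d quo_map_e.

Lemma quo_mapE i x : dgh_fun quo_map i (quo_proj p i x) = quo_proj q i (dgh_fun f i x).
Proof. exact: quo_map_proj. Qed.

End Functor.

Lemma commute_ker (X Y : dgmod t) (p : dg_idem X) (q : dg_idem Y) (f : dgHom X Y) :
  (forall i x, dgh_fun f i (p i x) = q i (dgh_fun f i x)) ->
  forall i x, p i x = 0 -> q i (dgh_fun f i x) = 0.
Proof. by move=> pf i x px; rewrite -pf px linear0. Qed.

(** As the maps commute with the idempotents, the sequence of quotients is, degree by degree, a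
    direct summand of the given exact sequence. *)
Lemma quo_map_exact (X' X X'' : dgmod t)
    (p' : dg_idem X') (p : dg_idem X) (p'' : dg_idem X'')
    (f : dgHom X' X) (g : dgHom X X'')
    (pf : forall i x, dgh_fun f i (p' i x) = p i (dgh_fun f i x))
    (pg : forall i x, dgh_fun g i (p i x) = p'' i (dgh_fun g i x)) :
  short_exact f g ->
  short_exact (quo_map (commute_ker pf)) (quo_map (commute_ker pg)).
Proof.
move=> fg i; have [fI gS ex] := fg i; split.
- move=> x y /(congr1 val); rewrite /= -!pf !quo_modP => /fI; exact: val_inj.
- move=> z; have [x xz] := gS (val z); exists (quo_proj p i x).
  by rewrite quo_mapE xz quo_projK.
move=> x; split=> [gx|[y <-]].
  have /ex [y yx] : dgh_fun g i (val x) = 0.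
    by have := congr1 val gx; rewrite /= -pg quo_modP.
  exists (quo_proj p' i y).
  by rewrite quo_mapE yx quo_projK.
rewrite (quo_projE y) !quo_mapE (_ : dgh_fun g i _ = 0) ?linear0 //.
by apply/ex; exists (val y).
Qed.

End Split.

(** * Extensions of dg-modules given by off-diagonal terms *)

Section Extension.
Variables (R : comPzRingType) (t : R).

(* The off-diagonal parts of d and e on an extension of X by K. *)
Record twist (X K : dgmod t) := Twist {
  tw_d : forall i, {linear X i.+1 -> K i};
  tw_e : forall i, {linear X i -> K i.+1};
  tw_dd : forall i x, tw_d i (cpx_d X i.+1 x) + cpx_d K i (tw_d i.+1 x) = 0;
  tw_e0 : forall x, tw_d 0%N (dg_e X 0 x) + cpx_d K 0 (tw_e 0%N x) = 0;
  tw_eS : forall i x, tw_d i.+1 (dg_e X i.+1 x) + cpx_d K i.+1 (tw_e i.+1 x)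
    + (tw_e i (cpx_d X i x) + dg_e K i (tw_d i x)) = 0
}.

Section Object.
Variables (X K : dgmod t) (w : twist X K).

Definition ext_mod i : lmodType R := (X i * K i)%type.

Definition ext_d i : {linear ext_mod i.+1 -> ext_mod i} :=
  lin_pair (cpx_d X i \o fst) ((tw_d w i \o fst) \+ (cpx_d K i \o snd)).

Definition ext_e i : {linear ext_mod i -> ext_mod i.+1} :=
  lin_pair (dg_e X i \o fst) ((tw_e w i \o fst) \+ (dg_e K i \o snd)).

Fact ext_dd i (x : ext_mod i.+2) : ext_d i (ext_d i.+1 x) = 0.
Proof. by congr (_, _); rewrite /= ?cpx_dd // linearD /= cpx_dd addr0 tw_dd. Qed.

Definition ext_cpx := Complex ext_dd.

Fact ext_e0 (x : ext_mod 0%N) : ext_d 0 (ext_e 0 x) = t *: x.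
Proof.
congr (_, _); rewrite /= ?dg_e0 // linearD /= dg_e0 addrA.
by rewrite tw_e0 add0r.
Qed.

Fact ext_eS i (x : ext_mod i.+1) :
  ext_d i.+1 (ext_e i.+1 x) + ext_e i (ext_d i x) = t *: x.
Proof.
congr (_, _); rewrite /= ?dg_eS // !linearD /=.
by rewrite (addrA (tw_d _ _ _)) (addrA (tw_e _ _ _)) addrACA tw_eS add0r dg_eS.
Qed.

Definition ext_dg : dgmod t := @DgMod _ _ ext_cpx ext_e ext_e0 ext_eS.

Definition ext_in_fun i : {linear K i -> ext_mod i} :=
  lin_pair \0 (idfun : {linear K i -> K i}).

Fact ext_in_d i (x : K i.+1) : ext_in_fun i (cpx_d K i x) = ext_d i (ext_in_fun i.+1 x).
Proof. by congr (_, _); rewrite /= ?linear0 ?add0r. Qed.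

Fact ext_in_e i (x : K i) : ext_in_fun i.+1 (dg_e K i x) = ext_e i (ext_in_fun i x).
Proof. by congr (_, _); rewrite /= ?linear0 ?add0r. Qed.

Definition ext_in : dgHom K ext_dg := @DgHom _ _ K ext_dg ext_in_fun ext_in_d ext_in_e.

Definition ext_out : dgHom ext_dg X :=
  @DgHom _ _ ext_dg X (fun i => fst : {linear ext_mod i -> X i})
    (fun i x => erefl) (fun i x => erefl).

Lemma ext_exact : short_exact ext_in ext_out.
Proof.
move=> i; split=> [x y [] //|z|[x k]] /=; first by exists (z, 0).
by split=> [->|[y [<- _]] //]; exists k.
Qed.

Lemma ext_in_P n : in_P n X -> in_P n K -> in_P n ext_dg.
Proof.
move=> [fgX X0] [fgK K0]; split=> [i|i ni [x k]]; first exact: fgp_prod (fgX i) (fgK i).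
by congr (_, _); [apply: X0 | apply: K0].
Qed.

End Object.

Section Functor.
Variables (X X' K K' : dgmod t) (w : twist X K) (w' : twist X' K').
Variables (f : dgHom X X') (g : dgHom K K').
Hypothesis fg_d : forall i x, dgh_fun g i (tw_d w i x) = tw_d w' i (dgh_fun f i.+1 x).
Hypothesis fg_e : forall i x, dgh_fun g i.+1 (tw_e w i x) = tw_e w' i (dgh_fun f i x).

Definition ext_map_fun i : {linear ext_mod X K i -> ext_mod X' K' i} :=
  prod_map (dgh_fun f i) (dgh_fun g i).

Fact ext_map_d i (x : ext_mod X K i.+1) :
  ext_map_fun i (ext_d w i x) = ext_d w' i (ext_map_fun i.+1 x).
Proof. by congr (_, _); rewrite /= ?linearD /= ?fg_d dgh_d. Qed.

Fact ext_map_e i (x : ext_mod X K i) :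
  ext_map_fun i.+1 (ext_e w i x) = ext_e w' i (ext_map_fun i x).
Proof. by congr (_, _); rewrite /= ?linearD /= ?fg_e dgh_e. Qed.

Definition ext_map : dgHom (ext_dg w) (ext_dg w') :=
  @DgHom _ _ (ext_dg w) (ext_dg w') ext_map_fun ext_map_d ext_map_e.

End Functor.

End Extension.

(** * Folding the top degree *)

Section Koszul.
Variables (R : comPzRingType) (s : R) (m : nat).

Section Object.
Variable X : dgmod s.

(* [X i.+2] in degree [i = m] and [X i.+1] in degree [i = m.+1] both stand for
   X_(m+2); indexing by i avoids transporting along equalities of degrees. *)
Definition kos_mod i : lmodType R :=
  (cond (i == m) (X i.+2) * cond (i == m.+1) (X i.+1))%type.

Definition kos_d i : {linear kos_mod i.+1 -> kos_mod i} :=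
  lin_pair (s \*: snd : {linear kos_mod i.+1 -> cond (i == m) (X i.+2)}) \0.

(** Together with [kos_d] this is the restriction to T_(s^2) of the T_s-module with d = s and e =
    1. *)
Definition kos_e i : {linear kos_mod i -> kos_mod i.+1} :=
  lin_pair \0 (s \*: fst : {linear kos_mod i -> cond (i.+1 == m.+1) (X i.+2)}).

Fact kos_dd i (x : kos_mod i.+2) : kos_d i (kos_d i.+1 x) = 0.
Proof. by congr (_, _); rewrite /= scaler0. Qed.

Definition kos_cpx := Complex kos_dd.

Fact kos_e0 (x : kos_mod 0%N) : kos_d 0 (kos_e 0 x) = s ^+ 2 *: x.
Proof.
case: x => v u; congr (_, _); rewrite /=; first by rewrite scalerA.
(* Degree 0 is never m + 1, so the second summand is zero there. *)
by rewrite [u]cond_eq0 // scaler0.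
Qed.

Fact kos_eS i (x : kos_mod i.+1) :
  kos_d i.+1 (kos_e i.+1 x) + kos_e i (kos_d i x) = s ^+ 2 *: x.
Proof. by congr (_, _); rewrite /= scalerA ?addr0 ?add0r. Qed.

Definition kos : dgmod (s ^+ 2) := @DgMod _ _ kos_cpx kos_e kos_e0 kos_eS.

Lemma kos_in_P n : in_P n X -> in_P m.+1 kos.
Proof.
move=> [fgX _]; split=> [i|i mi [v u]].
  by apply: fgp_prod; apply: fgp_cond; apply: fgX.
by congr (_, _); apply: cond_eq0; rewrite neq_ltn ?mi ?orbT // (ltn_trans _ mi) ?orbT.
Qed.

Hypothesis X0 : forall i, (m.+2 < i)%N -> forall x : X i, x = 0.

(** The other term of the homotopy relation, d e x, vanishes because e x has degree m + 3. *)
Lemma top_ed (x : X m.+2) : dg_e X m.+1 (cpx_d X m.+1 x) = s *: x.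
Proof. by rewrite -dg_eS (X0 _ (dg_e X _ x)) // linear0 add0r. Qed.

(** Since e^2 commutes with d, d e^2 x = 0 in degree 0. For m = 0 the element e^2 x has top degree,
    where e d = s. *)
Lemma top_eed0 (x : X 0%N) : m = 0%N -> s *: dg_e X 1 (dg_e X 0 x) = 0.
Proof.
move=> m0; have := X0; rewrite m0 => Z0.
have -> : s *: dg_e X 1 (dg_e X 0 x) = dg_e X 1 (cpx_d X 1 (dg_e X 1 (dg_e X 0 x))).
  by rewrite -dg_eS (@Z0 _ _ (dg_e X 2 _)) // linear0 add0r.
have -> : cpx_d X 1 (dg_e X 1 (dg_e X 0 x)) = 0.
  by apply: (addIr (dg_e X 0 (cpx_d X 0 (dg_e X 0 x))));
    rewrite dg_eS dg_e0 linearZ /= add0r.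
exact: linear0.
Qed.

(** Since e^2 commutes with d, the left side is e d e^2 x; and e^2 x has top degree m + 2, where e d
    = s. *)
Lemma e3d i (x : X i.+1) : i.+1 = m ->
  dg_e X i.+2 (dg_e X i.+1 (dg_e X i (cpx_d X i x))) = s *: dg_e X i.+2 (dg_e X i.+1 x).
Proof.
move=> im; have := X0; rewrite -im => Z0.
have -> : dg_e X i.+1 (dg_e X i (cpx_d X i x))
    = cpx_d X i.+2 (dg_e X i.+2 (dg_e X i.+1 x)).
  apply: (addrI (dg_e X i.+1 (cpx_d X i.+1 (dg_e X i.+1 x)))).
  by rewrite -linearD /= dg_eS addrC dg_eS linearZ.
by rewrite -dg_eS (@Z0 _ _ (dg_e X i.+3 _)) // linear0 add0r.
Qed.

(** The identity of X_(m+2), from degree m + 2 to its copy in degree m + 1, is what [fold] later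
    cancels. It feeds s = e d into degree m, and d d = 0 then dictates the sign of - e. *)
Definition stab_tw_d i : {linear X i.+1 -> kos_mod i} :=
  lin_pair (cproj (i == m) _ \o (\- dg_e X i.+1)) (cproj (i == m.+1) _).

(** By [e3d], e^3 d offsets the term - s e^2 obtained by applying [stab_tw_d] after s e. *)
Definition stab_tw_e i : {linear X i -> kos_mod i.+1} :=
  lin_pair (cproj (i.+1 == m) _ \o (dg_e X i.+2 \o (dg_e X i.+1 \o dg_e X i))) \0.

Fact stab_tw_dd i (x : X i.+2) :
  stab_tw_d i (cpx_d X i.+1 x) + kos_d i (stab_tw_d i.+1 x) = 0.
Proof.
congr (_, _); rewrite /=.
  (* Both terms are read in the same module, as [i.+1 == m.+1] computes to [i == m]. *)
  change (cproj (i == m) (X i.+2) (- dg_e X i.+1 (cpx_d X i.+1 x))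
    + s *: cproj (i == m) (X i.+2) x = 0).
  apply: cproj_addZ_eq0 => /eqP im; subst i.
  by rewrite top_ed addNr.
rewrite addr0; apply: cproj_eq0 => /eqP im; subst i.
by rewrite (X0 _ x) // linear0.
Qed.

Fact stab_tw_e0 (x : X 0%N) :
  stab_tw_d 0 (restr_e X 0 x) + kos_d 0 (stab_tw_e 0 x) = 0.
Proof.
congr (_, _); rewrite /= ?scaler0 addr0 //; apply: cproj_eq0 => /eqP m0.
by rewrite linearZ /= top_eed0 ?oppr0.
Qed.

Fact stab_tw_eS i (x : X i.+1) :
  stab_tw_d i.+1 (restr_e X i.+1 x) + kos_d i.+1 (stab_tw_e i.+1 x)
  + (stab_tw_e i (cpx_d X i x) + kos_e i (stab_tw_d i x)) = 0.
Proof.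
congr (_, _); rewrite /= ?scaler0 ?addr0 ?add0r ?addr0.
  apply: cproj_add_eq0 => /eqP im.
  by rewrite e3d // linearZ /= addNr.
change (cproj (i == m) (X i.+2) (s *: dg_e X i.+1 x)
  + s *: cproj (i == m) (X i.+2) (- dg_e X i.+1 x) = 0).
by apply: (@cproj_addZ_eq0 _ (i == m)) => _; rewrite /= scalerN addrN.
Qed.

Definition stab_tw : twist (restr_dg X) kos :=
  @Twist _ _ (restr_dg X) kos stab_tw_d stab_tw_e stab_tw_dd stab_tw_e0 stab_tw_eS.

Definition stab : dgmod (s ^+ 2) := ext_dg stab_tw.

(* The kernel is X_(m+2) in degree m+2 and its image under the differential,
   the set of (d u, (0, u)), in degree m+1. *)
Definition fold_idem_fun i : {linear stab i -> stab i} :=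
  lin_pair
    ((cut (i <= m.+1)%N (X i) \o fst)
     \- (cpx_d X i \o (cin (i == m.+1) (X i.+1) \o (snd \o snd))))
    (lin_pair (fst \o snd) \0 : {linear stab i -> kos_mod i}).

Lemma stab_eq i (x y : stab i) : x.1 = y.1 -> x.2 = y.2 -> x = y.
Proof. exact: injective_projections. Qed.

Lemma fold_idem_fst i (x : stab i) :
  (fold_idem_fun i x).1
  = (if (i <= m.+1)%N then x.1 else 0) - cpx_d X i (cin (i == m.+1) (X i.+1) x.2.2).
Proof. by rewrite /= cprojK. Qed.

Lemma fold_idem_eq0 i (x : stab i) : fold_idem_fun i x = 0 ->
  (if (i <= m.+1)%N then x.1 else 0) = cpx_d X i (cin (i == m.+1) (X i.+1) x.2.2)
  /\ x.2.1 = 0.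
Proof.
move=> x0; split; last by have := congr1 (fun z => z.2.1) x0.
by apply/eqP; rewrite -subr_eq0 -fold_idem_fst x0.
Qed.

Fact fold_idemK i (x : stab i) : fold_idem_fun i (fold_idem_fun i x) = fold_idem_fun i x.
Proof.
have E : (fold_idem_fun i (fold_idem_fun i x)).1 = (fold_idem_fun i x).1.
  rewrite !fold_idem_fst linear0 linear0 subr0.
  case: leqP => // im; by rewrite cin_eq0 ?gtn_eqF // linear0 subr0.
by apply: stab_eq.
Qed.

(** The kernel is zero up to degree m. In degree m + 1 it consists of the (d u, (0, u)), with
    differential (d d u, (s u - e d u, 0)) = 0 by [top_ed]. From degree m + 2, x goes to (d x, (0,
    x)), which is again in the kernel. *)
Fact fold_idem_d i (x : stab i.+1) :
  fold_idem_fun i.+1 x = 0 -> fold_idem_fun i (cpx_d stab i x) = 0.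
Proof.
case: x => x [v u] /fold_idem_eq0 /= [xu v0]; subst v.
have [im|im] := ltnP i m.
  have u0 : u = 0 by apply: cond_eq0; rewrite ltn_eqF.
  move: xu; rewrite u0 linear0 linear0 ltnS (ltnW im) => ->.
  exact: (linear0 (fold_idem_fun i \o cpx_d stab i)).
have [mi|mi] := ltnP m i.
  have u0 : u = 0 by apply: cond_eq0; rewrite gtn_eqF.
  apply: stab_eq; rewrite ?fold_idem_fst /= ?u0 ?scaler0 ?addr0 ?cprojK.
    case: leqP => [im1|im1]; last by rewrite (X0 _ x) // if_same linear0 subr0.
    by rewrite eqn_leq im1 mi subrr.
  by congr (_, _); apply: cproj_eq0; rewrite gtn_eqF.
have e : i = m by apply/eqP; rewrite eqn_leq mi im.
subst i; apply: stab_eq; rewrite ?fold_idem_fst /=.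
  rewrite addr0 !cprojK ltn_eqF // linear0 subr0 leqnSn.
  by rewrite ltnSn in xu; rewrite xu cpx_dd.
congr (_, _); rewrite ltnSn in xu; apply: (can_inj (@cinK _ _ _)).
rewrite linearD cprojK ifT // linearZ linear0 xu top_ed.
exact: addNr.
Qed.

(** The kernel is zero up to degree m and is everything from degree m + 2 on. *)
Fact fold_idem_e i (x : stab i) :
  fold_idem_fun i x = 0 -> fold_idem_fun i.+1 (dg_e stab i x) = 0.
Proof.
case: x => x [v u] /fold_idem_eq0 /= [xu v0]; subst v.
have [im|im] := leqP i m.
  have u0 : u = 0 by apply: cond_eq0; rewrite ltn_eqF.
  move: xu; rewrite u0 linear0 linear0 (leq_trans im) // => ->.
  exact: (linear0 (fold_idem_fun i.+1 \o dg_e stab i)).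
apply: stab_eq; rewrite ?fold_idem_fst /=.
  by rewrite cprojK ltnS leqNgt im scaler0 addr0 linear0 linear0 subr0.
by congr (_, _); rewrite addr0; apply: cproj_eq0; rewrite gtn_eqF // leqW.
Qed.

Definition fold_idem : dg_idem stab := DgIdem fold_idemK fold_idem_d fold_idem_e.

Definition fold : dgmod (s ^+ 2) := quo_dg fold_idem.

Lemma stab_in_P : in_P m.+2 X -> in_P m.+2 stab.
Proof.
move=> PX; apply: ext_in_P => //; have [fgK K0] := kos_in_P PX.
by split=> // i /ltnW; apply: K0.
Qed.

Lemma fold_in_P : in_P m.+2 X -> in_P m.+1 fold.
Proof.
move=> PX; apply: (quo_in_P (stab_in_P PX)) => i mi [x [v u]].
apply: stab_eq; rewrite ?fold_idem_fst /=.
  by rewrite leqNgt mi (cin_eq0 u) ?gtn_eqF // linear0 subr0.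
by congr (_, _); apply: cond_eq0; rewrite gtn_eqF // ltnW.
Qed.

Lemma fold_kerP i (x : sub_mod fold_idem i) :
  (if (i <= m.+1)%N then (val x).1 else 0) = cpx_d X i (cin (i == m.+1) (X i.+1) (val x).2.2)
  /\ (val x).2.1 = 0.
Proof. by apply: fold_idem_eq0; apply: (sub_modP x). Qed.

Lemma fold_ker_eq0 i (x : sub_mod fold_idem i) : (i <= m)%N -> x = 0.
Proof.
move=> im; apply: val_inj; have := fold_kerP x.
case: (val x) => y [v u] /= [].
have u0 : u = 0 by apply: cond_eq0; rewrite ltn_eqF.
by rewrite u0 linear0 linear0 leqW // => -> ->.
Qed.

(** The kernel is X_(m+2) mapped isomorphically onto the elements (d u, (0, u)): the last coordinate
    recovers u. *)
Lemma fold_ker_acyclic : acyclic (sub_dg fold_idem).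
Proof.
split=> [x|i x dx]; first by exists 0; rewrite linear0 (fold_ker_eq0 x).
have [im|im] := leqP i.+1 m; first by exists 0; rewrite linear0 (fold_ker_eq0 x).
(* From degree m + 2 on a cycle is zero: in degree m + 2 it is the last coordinate of its own
   differential, and above that [X] vanishes. *)
have [mi|mi] := ltnP m i.
  exists 0; rewrite linear0; apply: val_inj; move/(congr1 val): dx.
  have := fold_kerP x; rewrite /=; case: (ker_val x) => y [v u] /= [_ v0].
  have u0 : u = 0 by apply: cond_eq0; rewrite gtn_eqF.
  rewrite /= v0 u0 => -[_ _]; rewrite addr0.
  move=> /(congr1 (cin (i == m.+1) _)); rewrite cprojK linear0.
  case: eqP => [_ -> //|ni _]; rewrite (X0 _ y) // ltnS ltn_neqAle mi andbT.
  by apply/eqP => /esym.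
have e : i = m by apply/eqP; rewrite eqn_leq mi -ltnS im.
subst i; have xE := fold_kerP x.
case: {dx im mi} x xE => -[y [v u]] kx /= [yu v0]; rewrite ltnSn in yu.
(* The preimage of (d u, (0, u)) is u placed in degree m + 2. *)
have kz : (cin (m.+1 == m.+1) (X m.+2) u, (0, 0)) \in ker_pred (fold_idem m.+2).
  rewrite inE; apply/eqP/stab_eq; rewrite ?fold_idem_fst /= ?ltnn //.
  by rewrite linear0 linear0 subr0.
exists (Ker kz); apply: val_inj; apply: stab_eq; rewrite /= ?yu //.
rewrite v0; congr (_, _); last by rewrite addr0 cinK.
by rewrite scaler0 addr0; apply: cproj_eq0; rewrite gtn_eqF.
Qed.

End Object.
End Koszul.

(** * Functoriality and exactness of [kos] and [fold] *)

Section FoldFunctor.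
Variables (R : comPzRingType) (s : R) (m : nat).

Section Map.
Variables (X Y : dgmod s) (f : dgHom X Y).

Definition kos_map_fun i : {linear kos_mod m X i -> kos_mod m Y i} :=
  prod_map (cmap (i == m) (dgh_fun f i.+2)) (cmap (i == m.+1) (dgh_fun f i.+1)).

Fact kos_map_d i (x : kos_mod m X i.+1) :
  kos_map_fun i (kos_d m X i x) = kos_d m Y i (kos_map_fun i.+1 x).
Proof. by congr (_, _); rewrite /= ?linearZ ?linear0. Qed.

Fact kos_map_e i (x : kos_mod m X i) :
  kos_map_fun i.+1 (kos_e m X i x) = kos_e m Y i (kos_map_fun i x).
Proof. by congr (_, _); rewrite /= ?linearZ ?linear0. Qed.

Definition kos_map : dgHom (kos m X) (kos m Y) :=
  @DgHom _ _ (kos m X) (kos m Y) kos_map_fun kos_map_d kos_map_e.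

Hypotheses (X0 : forall i, (m.+2 < i)%N -> forall x : X i, x = 0)
           (Y0 : forall i, (m.+2 < i)%N -> forall x : Y i, x = 0).

Fact stab_map_d i (x : restr_dg X i.+1) :
  dgh_fun kos_map i (tw_d (stab_tw X0) i x)
  = tw_d (stab_tw Y0) i (dgh_fun (restr_hom f) i.+1 x).
Proof. by congr (_, _); rewrite /= -cproj_nat ?linearN ?dgh_e. Qed.

Fact stab_map_e i (x : restr_dg X i) :
  dgh_fun kos_map i.+1 (tw_e (stab_tw X0) i x)
  = tw_e (stab_tw Y0) i (dgh_fun (restr_hom f) i x).
Proof. by congr (_, _); rewrite /= ?linear0 // -cproj_nat !dgh_e. Qed.

Definition stab_map : dgHom (stab X0) (stab Y0) := ext_map stab_map_d stab_map_e.

Lemma stab_map_idem i x :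
  dgh_fun stab_map i (fold_idem X0 i x) = fold_idem Y0 i (dgh_fun stab_map i x).
Proof.
apply: stab_eq; last by congr (_, _); rewrite /= linear0.
rewrite /= linearB dgh_d !cprojK cin_cmap; congr (_ - _).
by case: ifP; rewrite ?linear0.
Qed.

Definition fold_map : dgHom (fold X0) (fold Y0) := quo_map (commute_ker stab_map_idem).

End Map.

Section Exact.
Variables (X' X X'' : dgmod s) (f : dgHom X' X) (g : dgHom X X'').
Hypotheses (X'0 : forall i, (m.+2 < i)%N -> forall x : X' i, x = 0)
           (X0 : forall i, (m.+2 < i)%N -> forall x : X i, x = 0)
           (X''0 : forall i, (m.+2 < i)%N -> forall x : X'' i, x = 0).
Hypothesis fg : short_exact f g.

Lemma kos_map_exact : short_exact (kos_map f) (kos_map g).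
Proof. by move=> i; apply: exact3_prod; apply: exact3_cmap; apply: fg. Qed.

Lemma fold_map_exact : short_exact (fold_map f X'0 X0) (fold_map g X0 X''0).
Proof. by apply: quo_map_exact => i; apply: exact3_prod (fg i) (kos_map_exact i). Qed.

End Exact.

Section Cancel.
Variables (X Y : dgmod s) (f : dgHom X Y) (g : dgHom Y X).
Hypotheses (X0 : forall i, (m.+2 < i)%N -> forall x : X i, x = 0)
           (Y0 : forall i, (m.+2 < i)%N -> forall x : Y i, x = 0).
Hypothesis gf : forall i x, dgh_fun g i (dgh_fun f i x) = x.

Lemma kos_mapK i x : dgh_fun (kos_map g) i (dgh_fun (kos_map f) i x) = x.
Proof.
by case: x => v u; congr (_, _); apply: (can_inj (@cinK _ _ _)); rewrite !cin_cmap gf.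
Qed.

Lemma fold_mapK i x :
  dgh_fun (fold_map g Y0 X0) i (dgh_fun (fold_map f X0 Y0) i x) = x.
Proof.
rewrite (quo_projE x) (quo_mapE (commute_ker (@stab_map_idem _ _ f X0 Y0))).
rewrite (quo_mapE (commute_ker (@stab_map_idem _ _ g Y0 X0))); congr (quo_proj _ _ _).
by apply: stab_eq; [apply: gf | apply: kos_mapK].
Qed.

End Cancel.

Lemma kos_iso (X Y : dgmod s) : dg_iso X Y -> dg_iso (kos m X) (kos m Y).
Proof.
by move=> [f [g [gf fg]]]; exists (kos_map f), (kos_map g); split; apply: kos_mapK.
Qed.

Lemma fold_iso (X Y : dgmod s) (X0 : forall i, (m.+2 < i)%N -> forall x : X i, x = 0)
    (Y0 : forall i, (m.+2 < i)%N -> forall x : Y i, x = 0) :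
  dg_iso X Y -> dg_iso (fold X0) (fold Y0).
Proof.
move=> [f [g [gf fg]]]; exists (fold_map f X0 Y0), (fold_map g Y0 X0).
by split; apply: fold_mapK.
Qed.

End FoldFunctor.

(** * Splitting off the top degree along a retraction of d *)

Section TopSplit.
Variables (R : comPzRingType) (s : R) (m : nat) (X : dgmod s).
Hypothesis X0 : forall i, (m.+2 < i)%N -> forall x : X i, x = 0.
Variable h : forall i, {linear X i -> X i.+1}.
Hypothesis hd : forall x : X m.+2, h m.+1 (cpx_d X m.+1 x) = x.

(** As h d = 1 on X_(m+2), the kernel is d X_(m+2) in degree m + 1 and everything above. Keeping [h]
    indexed by all degrees and testing [i == m.+1] avoids transport. *)
Definition top_idem_fun i : {linear X i -> X i} :=
  cut (i <= m.+1)%N (X i) \o (idfun \- (cpx_d X i \o (cut (i == m.+1) (X i.+1) \o h i))).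

Lemma top_idemE i x :
  top_idem_fun i x
  = if (i <= m.+1)%N then x - cpx_d X i (if i == m.+1 then h i x else 0) else 0.
Proof. by rewrite /= !cprojK. Qed.

Lemma top_idem_low i x : (i <= m)%N -> top_idem_fun i x = x.
Proof. by move=> im; rewrite top_idemE leqW // ltn_eqF // linear0 subr0. Qed.

Lemma top_idem_top x : top_idem_fun m.+1 x = x - cpx_d X m.+1 (h m.+1 x).
Proof. by rewrite top_idemE leqnn eqxx. Qed.

Lemma top_idem_high i x : (m.+1 < i)%N -> top_idem_fun i x = 0.
Proof. by move=> im; rewrite top_idemE leqNgt im. Qed.

Variant degree_spec i : Prop :=
  | LowDegree of (i <= m)%N
  | TopDegree of i = m.+1
  | HighDegree of (m.+1 < i)%N.

Lemma degreeP i : degree_spec i.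
Proof.
case: (ltngtP i m.+1) => im.
- by apply: LowDegree.
- by apply: HighDegree.
- by apply: TopDegree.
Qed.

Fact top_idemK i x : top_idem_fun i (top_idem_fun i x) = top_idem_fun i x.
Proof.
case: (degreeP i) => im; first by rewrite !top_idem_low.
  by subst i; rewrite !top_idem_top linearB /= hd subrr linear0 subr0.
by rewrite !top_idem_high.
Qed.

(** In degree m + 1 the kernel consists of boundaries, and it contains every boundary because h d =
    1. *)
Fact top_idem_d i x : top_idem_fun i.+1 x = 0 -> top_idem_fun i (cpx_d X i x) = 0.
Proof.
case: (degreeP i.+1) => [im|[im]|im].
- by rewrite top_idem_low // => ->; rewrite linear0 linear0.
- subst i; rewrite top_idem_top top_idem_low // => /eqP; rewrite subr_eq0 => /eqP ->.
  by rewrite cpx_dd.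
move=> _; have [im1|im1] := ltnP m.+1 i; first by rewrite top_idem_high.
have e : i = m.+1 by apply/eqP; rewrite eqn_leq im1.
by subst i; rewrite top_idem_top hd subrr.
Qed.

Fact top_idem_e i x : top_idem_fun i x = 0 -> top_idem_fun i.+1 (restr_e X i x) = 0.
Proof.
have [im|im] := leqP i m; last by rewrite (@top_idem_high i.+1).
by rewrite top_idem_low // => ->; rewrite linear0 linear0.
Qed.

Definition top_idem : dg_idem (restr_dg X) :=
  @DgIdem _ _ (restr_dg X) top_idem_fun top_idemK top_idem_d top_idem_e.

Definition top_quo : dgmod (s ^+ 2) := quo_dg top_idem.

Lemma top_quo_in_P : in_P m.+2 X -> in_P m.+1 top_quo.
Proof.
move=> PX; apply: (@quo_in_P _ _ (restr_dg X) top_idem _ _ PX) => i im x.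
exact: top_idem_high.
Qed.

Definition kos_fold : dgHom (kos m X) (fold X0) :=
  dg_comp (quo_hom (fold_idem X0)) (ext_in (stab_tw X0)).

(** In degree m + 1 the kernel of [fold_idem] consists of the (d u, (0, u)), whose first coordinates
    are boundaries and so are killed by [top_idem]. *)
Fact fold_top_ker i x :
  fold_idem X0 i x = 0 -> top_idem i (dgh_fun (ext_out (stab_tw X0)) i x) = 0.
Proof.
case: x => x [v u] /fold_idem_eq0 [/= xu _]; rewrite -[LHS]/(top_idem_fun i x).
case: (degreeP i) => im; last by rewrite top_idem_high.
  have u0 : u = 0 by apply: cond_eq0; rewrite ltn_eqF.
  by rewrite top_idem_low //; move: xu; rewrite u0 linear0 linear0 leqW.
by subst i; rewrite leqnn in xu; rewrite xu top_idem_top hd subrr.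
Qed.

Definition fold_top : dgHom (fold X0) top_quo := quo_map fold_top_ker.

Lemma fold_topE i (y : fold X0 i) : val (dgh_fun fold_top i y) = top_idem_fun i (val y).1.
Proof. by []. Qed.

Lemma kos_foldE i (x : kos m X i) : val (dgh_fun kos_fold i x) = fold_idem X0 i (0, x).
Proof. by []. Qed.

(** The first map sends (v, u) to (- d u, (v, 0)); it is injective because d u = 0 gives u = h d u =
    0. *)
Lemma kos_fold_exact : short_exact kos_fold fold_top.
Proof.
move=> i; split.
- apply: raddf_inj => -[v u] /(congr1 val).
  rewrite kos_foldE => /fold_idem_eq0 [/= du ->].
  rewrite if_same in du; congr (_, _); apply: (can_inj (@cinK _ _ _)).
  case: (degreeP i) => e; first by rewrite (cond_eq0 u) // ltn_eqF.
    by subst i; rewrite linear0 -[LHS]hd -du linear0.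
  by rewrite (cond_eq0 u) // gtn_eqF.
- move=> z; exists (quo_proj (fold_idem X0) i (val z, 0)).
  by rewrite (quo_mapE fold_top_ker); apply: quo_projK.
move=> y; split=> [/(congr1 val)|[x <-]]; last first.
  rewrite [LHS](quo_mapE fold_top_ker (ext_in_fun (restr_dg X) (kos m X) i x)).
  exact: (linear0 (quo_proj top_idem i)).
rewrite fold_topE /=; have /= yE := quo_modP y; move: yE.
case E : (ker_val y) => [x [v u]] [xE u0] xt.
(* In degree m + 1 an x killed by [top_idem] satisfies x = d h x, so u = - h x gives - d u = x. In
   all other degrees x = 0. *)
exists (v, cproj (i == m.+1) (X i.+1) (- h i x)).
apply: val_inj.
rewrite -[LHS]/(fold_idem X0 i (0, (v, cproj (i == m.+1) (X i.+1) (- h i x)))) /= E.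
apply: (stab_eq (X0 := X0)) => /=; last by rewrite u0.
rewrite cprojK if_same sub0r.
move: xE xt; rewrite -u0 /= !cprojK linear0 linear0 subr0; case: ifP => im.
  move=> _ /eqP; rewrite subr_eq0 => /eqP {2}->.
  by case: ifP; rewrite ?linearN ?opprK // !linear0.
move=> <- _; rewrite gtn_eqF ?linear0 // ltnNge im //.
Qed.

End TopSplit.

(** By induction, 1 - h d has values in the cycles, onto which the next differential is surjective.
    Projectivity lifts it to k with d k = 1 - h d, whence d k d = d. The form d h d = d involves a
    single map, so each step has to remember only the previous one. *)
Lemma projective_contraction (R : comPzRingType) (C : complex R) :
  (forall i, projective (C i)) -> acyclic C ->
  forall i, exists h : {linear C i -> C i.+1},
    forall x : C i.+1, cpx_d C i (h (cpx_d C i x)) = cpx_d C i x.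
Proof.
move=> projC [C0 CS]; elim=> [|i [h hP]].
  have [h hP] := projC 0%N _ _ (cpx_d C 0) idfun C0.
  by exists h => x; rewrite hP.
have bd x : cpx_d C i ((idfun \- (h \o cpx_d C i)) x) = 0.
  by rewrite linearB /= hP subrr.
have sur : forall b, exists a, ker_lift (@cpx_dd _ C i) a = b.
  by move=> b; have [a ab] := CS i _ (kerP b); exists a; apply: val_inj.
have [k kP] := projC i.+1 _ _ _ (ker_lift bd) sur.
exists k => x; have /= -> := congr1 val (kP (cpx_d C i.+1 x)).
by rewrite cpx_dd linear0 subr0.
Qed.

(** * Acyclicity of the part split off and of the quotient *)

Section TopQuotientHomology.
Variables (R : comPzRingType) (s : R) (m : nat) (X : dgmod s).
Hypothesis X0 : forall i, (m.+2 < i)%N -> forall x : X i, x = 0.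
Variable h : forall i, {linear X i -> X i.+1}.
Hypothesis hd : forall x : X m.+2, h m.+1 (cpx_d X m.+1 x) = x.

Lemma top_ker_low i (x : sub_mod (top_idem hd) i) : (i <= m)%N -> x = 0.
Proof.
move=> im; apply: val_inj; rewrite /= -(top_idem_low h (val x) im).
exact: (sub_modP x).
Qed.

(** An element x of the kernel in degree m + 1 equals d h x, so h x is a preimage; on X_(m+2) the
    differential is injective because h d = 1. *)
Lemma top_sub_acyclic : acyclic (sub_dg (top_idem hd)).
Proof.
split=> [x|i x dx]; first by exists 0; rewrite linear0 (top_ker_low x).
case: (degreeP m i.+1) => [im|[im]|im].
- by exists 0; rewrite linear0 (top_ker_low x).
- subst i; have kz : h m.+1 (val x) \in ker_pred (top_idem hd m.+2).
    by rewrite inE; apply/eqP/top_idem_high.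
  exists (Ker kz); apply: val_inj; rewrite /=.
  apply/esym/eqP; rewrite -subr_eq0 -top_idem_top; apply/eqP; exact: (sub_modP x).
exists 0; rewrite linear0; apply: val_inj; rewrite /=; apply/esym.
have [im1|im1] := ltnP m.+1 i; first exact: X0.
have e : i = m.+1 by apply/eqP; rewrite eqn_leq im1.
subst i; have dx0 : cpx_d X m.+1 (val x) = 0 := congr1 val dx.
by rewrite -[LHS]hd dx0 linear0.
Qed.

Lemma top_quo_acyclic : acyclic X -> acyclic (top_quo hd).
Proof. by move=> aX; apply: quo_acyclic => //; apply: top_sub_acyclic. Qed.

End TopQuotientHomology.

(** * The homomorphism on Grothendieck groups *)

Section AbelianGroups.
Variable A : abGroup.
Implicit Types a b c : A.

Lemma ab_addr0 a : ab_add a (ab_zero A) = a.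
Proof. by rewrite ab_addC ab_add0. Qed.

Lemma ab_addKr a b : ab_add (ab_add a b) (ab_opp a) = b.
Proof. by rewrite ab_addC ab_addA ab_addN ab_add0. Qed.

Lemma ab_addACA a b c d :
  ab_add (ab_add a b) (ab_add c d) = ab_add (ab_add a c) (ab_add b d).
Proof. by rewrite -!ab_addA; congr (ab_add a _); rewrite !ab_addA (ab_addC b). Qed.

Lemma ab_oppD a b : ab_opp (ab_add a b) = ab_add (ab_opp a) (ab_opp b).
Proof.
apply/esym; rewrite -[RHS]ab_add0 -(ab_add0 (ab_zero A)).
rewrite -{1}(ab_addN a) -(ab_addN b) ab_addACA -ab_addA [ab_add (ab_add a b) _]ab_addC.
by rewrite ab_addN ab_addr0.
Qed.

End AbelianGroups.

Section Comp.
Variables (A B C : abGroup) (g : abHom B C) (f : abHom A B).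
Fact ab_compD x y : (g \o f) (ab_add x y) = ab_add ((g \o f) x) ((g \o f) y).
Proof. by rewrite /= !ab_funD. Qed.
Definition ab_comp : abHom A C := AbHom ab_compD.
End Comp.

Section Classes.
Variables (R : comPzRingType) (t : R) (n : nat).

Definition Gcls (X : PT t n) : G t n := cls (@G_rel R t n) X.

Lemma Gcls_iso (X Y : PT t n) : dg_iso X Y -> Gcls X = Gcls Y.
Proof. by move=> XY; apply/pi_eqP/weq_rel/G_iso. Qed.

Lemma Gcls_ses (X' X X'' : PT t n) (f : dgHom X' X) (g : dgHom X X'') :
  short_exact f g -> Gcls X = ab_add (Gcls X') (Gcls X'').
Proof.
move=> fg.
have <- : Defs.pi (@G_rel R t n) (Add (Gen X') (Gen X''))
    = ab_add (Gcls X') (Gcls X'').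
  by rewrite Defs.pi_add.
by apply/pi_eqP/weq_rel/(G_ses fg).
Qed.

Lemma Gcls_acyclic (X : PT t n) : acyclic X -> Gcls X = ab_zero (G t n).
Proof. by move=> aX; apply/pi_eqP/weq_rel/G_acyclic. Qed.

End Classes.

(** * The homomorphism W and its two composites with i *)

Section Transfer.
Variables (R : comPzRingType) (s : R) (m : nat).
Implicit Types X : PT s m.+2.

Definition top0 X : forall i, (m.+2 < i)%N -> forall x : X i, x = 0 := (pt_in_P X).2.

Definition kos_pt X : PT (s ^+ 2) m.+1 := PTObj (kos_in_P m (pt_in_P X)).
Definition fold_pt X : PT (s ^+ 2) m.+1 := PTObj (fold_in_P (top0 (X := X)) (pt_in_P X)).

Definition transfer_cls X : G (s ^+ 2) m.+1 :=
  ab_add (Gcls (fold_pt X)) (ab_opp (Gcls (kos_pt X))).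

Section SplitTop.
Variables (X : PT s m.+2) (h : forall i, {linear X i -> X i.+1}).
Hypothesis hd : forall x : X m.+2, h m.+1 (cpx_d X m.+1 x) = x.

Definition top_quo_pt : PT (s ^+ 2) m.+1 := PTObj (top_quo_in_P hd (pt_in_P X)).

Lemma transfer_split : transfer_cls X = Gcls top_quo_pt.
Proof.
have := @Gcls_ses _ _ _ (kos_pt X) (fold_pt X) top_quo_pt _ _
  (kos_fold_exact (top0 (X := X)) hd).
by rewrite /transfer_cls => ->; rewrite ab_addKr.
Qed.

End SplitTop.

Lemma transfer_acyclic X : acyclic X -> transfer_cls X = ab_zero _.
Proof.
move=> aX; have projX i : projective (X i) by case: ((pt_in_P X).1 i).
pose h i := sval (constructive_indefinite_description _
  (projective_contraction projX aX i)).
have hP i (x : X i.+1) : cpx_d X i (h i (cpx_d X i x)) = cpx_d X i x.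
  by rewrite /h; case: constructive_indefinite_description.
have hd (x : X m.+2) : h m.+1 (cpx_d X m.+1 x) = x.
  apply/eqP; rewrite -subr_eq0; apply/eqP.
  (* The difference h d x - x is a cycle of degree m + 2, hence a boundary from degree m + 3, where
     [X] is zero. *)
  have [|y <-] := aX.2 m.+1 (h m.+1 (cpx_d X m.+1 x) - x).
    by rewrite linearB /= hP subrr.
  by rewrite (@top0 X _ _ y) ?linear0.
rewrite (transfer_split hd); apply: Gcls_acyclic.
by apply: top_quo_acyclic => //; apply: top0.
Qed.

(** The three kinds of relation use functoriality, exactness of [kos] and [fold], and vanishing on
    acyclic modules. *)
Lemma transfer_rel u v : G_rel u v -> weval transfer_cls u = weval transfer_cls v.
Proof.
case=> [X Y XY|X' X X'' f g fg|X aX] /=; last exact: transfer_acyclic.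
- rewrite /transfer_cls (Gcls_iso (kos_iso m XY : dg_iso (kos_pt X) (kos_pt Y))).
  by rewrite (Gcls_iso (fold_iso _ _ XY : dg_iso (fold_pt X) (fold_pt Y))).
rewrite /transfer_cls.
rewrite (@Gcls_ses _ _ _ (kos_pt X') (kos_pt X) (kos_pt X'') _ _ (kos_map_exact m fg)).
rewrite (@Gcls_ses _ _ _ (fold_pt X') (fold_pt X) (fold_pt X'') _ _
  (fold_map_exact _ _ _ fg)).
by rewrite ab_oppD ab_addACA.
Qed.

Definition transfer : abHom (G s m.+2) (G (s ^+ 2) m.+1) := pres_lift transfer_rel.

Lemma transferE X : transfer (Gcls X) = transfer_cls X.
Proof. exact: pres_lift_cls. Qed.

Lemma transfer_incl (X : PT s m.+1) :
  transfer_cls (incl (leq_pred m.+2) X) = Gcls (restr X).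
Proof.
have Xtop (x : X m.+2) : x = 0 by apply: (pt_in_P X).2.
have hd (x : X m.+2) : (\0 : {linear X m.+1 -> X m.+2}) (cpx_d X m.+1 x) = x.
  by rewrite [RHS]Xtop.
rewrite (@transfer_split (incl (leq_pred m.+2) X) (fun i => \0) hd).
set p := @top_idem R s m X (fun i => \0) hd.
(* The quotient is carried by a subtype, so it is not literally [X]. The exact sequence with the
   acyclic kernel [K] identifies the two classes. *)
pose K : PT (s ^+ 2) m.+1 := PTObj (sub_in_P p (pt_in_P X)).
have aK : acyclic K by apply: top_sub_acyclic => i im; apply: (pt_in_P X).2; apply: ltnW.
have := @Gcls_ses _ _ _ K (restr X)
  (@top_quo_pt (incl (leq_pred m.+2) X) (fun i => \0) hd) _ _ (sub_quo_exact p).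
by rewrite (Gcls_acyclic aK) ab_add0 => ->.
Qed.

(** The class of [stab] is computed twice: as [fold] from the quotient by an acyclic submodule, and
    as [kos] + [X] from the extension. *)
Lemma incl_transfer X : G_incl (s ^+ 2) (leq_pred m.+2) (transfer_cls X) = Gcls (restr X).
Proof.
rewrite ab_funD abHomN !G_inclE.
pose X0 := @top0 X.
pose F : PT (s ^+ 2) m.+2 := PTObj (stab_in_P X0 (pt_in_P X)).
pose C : PT (s ^+ 2) m.+2 := PTObj (sub_in_P (fold_idem X0) (stab_in_P X0 (pt_in_P X))).
have FY := @Gcls_ses _ _ _ C F (incl (leq_pred m.+2) (fold_pt X)) _ _
  (sub_quo_exact (fold_idem X0)).
have aC : acyclic C by apply: fold_ker_acyclic.
have FK := @Gcls_ses _ _ _ (incl (leq_pred m.+2) (kos_pt X)) F (restr X) _ _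
  (ext_exact (stab_tw X0)).
by rewrite FY (Gcls_acyclic aC) ab_add0 in FK; rewrite -[cls _ _]/(Gcls _) FK ab_addKr.
Qed.

End Transfer.

Theorem proposition1p9 (R : comPzRingType) (s : R) (n : nat) (hn : (2 <= n)%N) :
  exists W : abHom (G s n) (G (s ^+ 2) n.-1),
    (forall x : G s n.-1, W (G_incl s (leq_pred n) x) = G_restr s n.-1 x) /\
    (forall x : G s n, G_incl (s ^+ 2) (leq_pred n) (W x) = G_restr s n x).
Proof.
case: n hn => [|[|m]] // _; exists (transfer s m); split.
  (* Homomorphisms out of G are compared on the classes of objects. *)
  apply: (@pres_hom_ext _ _ _ (ab_comp (transfer s m) (G_incl s (leq_pred m.+2)))) => X.
  rewrite [LHS](congr1 (transfer s m) (G_inclE (leq_pred m.+2) X)).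
  by rewrite [RHS]G_restrE [LHS]transferE transfer_incl.
apply: (@pres_hom_ext _ _ _
  (ab_comp (G_incl (s ^+ 2) (leq_pred m.+2)) (transfer s m))) => X.
rewrite [LHS](congr1 (G_incl _ _) (transferE X)).
by rewrite [RHS]G_restrE incl_transfer.
Qed.
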